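(* Let $A,B\in\mathbb{M}_n^+$ and $Z\in\mathbb{M}_n$. Then, for all symmetric norms $\|\cdot\|$ on $\mathbb{M}_n$ and all $\alpha>0$, the map $$(p,t)\mapsto \left\|\,\left|A^{t/p}ZB^{t/p}\right|^{\alpha p}\right\|$$ is jointly log-convex on $(0,\infty)\times(-\infty,\infty)$.
   Context: $\mathbb{M}_n$ is the space of $n\times n$ complex matrices, $\mathbb{M}_n^+$ its positive semidefinite part, and $|X|=(X^*X)^{1/2}$. A norm on $\mathbb{M}_n$ is symmetric if $\|UXV\|=\|X\|$ for all $X\in\mathbb{M}_n$ and all unitary $U,V\in\mathbb{M}_n$. If $A\in\mathbb{M}_n^+$ is not invertible, then for $t\ge0$ one sets $A^{-t}:=(A+F)^{-t}E$, where $F$ is the projection onto the nullspace of $A$ and $E$ is the range projection of $A$ (so $A^0=E$). A function $f\ge 0$ on a convex set is (jointly) log-convex if $f(\lambda x+(1-\lambda)y)\le f(x)^{\lambda}f(y)^{1-\lambda}$ for all $x,y$ in the set and $\lambda\in(0,1)$; the zero function is log-convex. *)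

(* Defs.v *)
From mathcomp Require Import all_boot all_order all_algebra.
From mathcomp Require Import sesquilinear spectral.
From mathcomp Require Import complex.
From mathcomp Require Import boolp classical_sets set_interval reals exp.

Set Implicit Arguments.
Unset Strict Implicit.
Unset Printing Implicit Defensive.

Import Order.TTheory GRing.Theory Num.Theory.
Local Open Scope ring_scope.
Local Open Scope sesquilinear_scope.

Definition psdmx (R : realType) (n : nat) (A : 'M[R[i]]_n) : Prop :=
  A \is hermsymmx /\ forall v : 'cV[R[i]]_n, 0 <= (v ^t* *m A *m v) 0 0.

(* Functional calculus of a Hermitian matrix for a real function [f]; on
   non-normal matrices the spectral decomposition is meaningless. *)
Definition mxfun (R : realType) (n : nat) (f : R -> R) (A : 'M[R[i]]_n) :
    'M[R[i]]_n :=
  let P := spectralmx A in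
  invmx P *m
  diag_mx (map_mx (fun z => real_complex R (f (complex.Re z))) (spectral_diag A))
  *m P.

(* The row-space operations of the library act on row vectors; the transposes
   turn them into the orthogonal projections onto the range and the nullspace
   of [A] acting on column vectors. *)
Definition range_proj (R : realType) (n : nat) (A : 'M[R[i]]_n) : 'M[R[i]]_n :=
  (proj_ortho A^T)^T.

Definition null_proj (R : realType) (n : nat) (A : 'M[R[i]]_n) : 'M[R[i]]_n :=
  (proj_ortho (kermx A^T))^T.

(* [A ^ s] for positive semidefinite [A] and real [s].  For [s <= 0] it is
   [(A + F) ^ s E], with [F] and [E] the projections onto the nullspace and the
   range; when [A] is invertible, [F = 0] and [E = 1], so no case distinction
   on invertibility is needed. *)
Definition mxpow (R : realType) (n : nat) (A : 'M[R[i]]_n) (s : R) :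
    'M[R[i]]_n :=
  if 0 < s then mxfun (fun x => powR x s) A
  else mxfun (fun x => powR x s) (A + null_proj A) *m range_proj A.

Definition mxabs (R : realType) (n : nat) (X : 'M[R[i]]_n) : 'M[R[i]]_n :=
  mxpow (X ^t* *m X) 2^-1.

Record is_matrix_norm (R : realType) (n : nat) (N : 'M[R[i]]_n -> R) : Prop := {
  matrix_normD : forall X Y, N (X + Y) <= N X + N Y;
  matrix_normZ : forall (c : R[i]) X, N (c *: X) = complex.Re `|c| * N X;
  matrix_norm_eq0 : forall X, N X = 0 -> X = 0
}.

Definition symmetric_norm (R : realType) (n : nat) (N : 'M[R[i]]_n -> R) : Prop :=
  is_matrix_norm N /\
  forall X U V : 'M[R[i]]_n,
    U \is unitarymx -> V \is unitarymx -> N (U *m X *m V) = N X.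

(* [D] is meant to be convex; [powR 0 l = 0] for [l != 0], so the zero function
   is log-convex. *)
Definition log_convex_on (R : realType) (E : lmodType R) (D : set E)
    (f : E -> R) : Prop :=
  (forall x, D x -> 0 <= f x) /\
  forall (x y : E) (l : R), D x -> D y -> 0 < l -> l < 1 ->
    f (l *: x + (1 - l) *: y) <= powR (f x) l * powR (f y) (1 - l).

(* Main.v *)
Require Import Defs.
From mathcomp Require Import all_boot all_order all_algebra.
From mathcomp Require Import fingroup perm.
From mathcomp Require Import sesquilinear spectral.
From mathcomp Require Import complex.
From mathcomp Require Import boolp classical_sets set_interval reals exp.
From mathcomp Require Import ring lra.

(* For [k <= n] let [f(s)] be the product of the [k] largest eigenvalues of
   [X(s)^* X(s)], where [X(s) = A^s Z B^s]. The heart of the proof is the midpoint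
   inequality [f((s + t) / 2) ^ 2 <= f(s) f(t)]: with [m = (s + t) / 2], the
   matrix [B^(s - m)] maps the eigenvectors of [X(m)^* X(m)] to those of
   [X(s)^* X(t)], and the Cauchy-Schwarz inequality for [k x k] Gram determinants
   (from the Cauchy-Binet formula) applies. As [f] is bounded on segments, it is
   log-convex.
   Since [T / P] is the barycenter of [t / p] and [t' / p'] with weights
   proportional to [l p] and [(1 - l) p'] when [P = l p + (1 - l) p'] and
   [T = l t + (1 - l) t'], this says that the singular values of
   [|X(T / P)|^(alpha P)] are weakly log-majorized by the geometric means of those
   of [|X(t / p)|^(alpha p)] and [|X(t' / p')|^(alpha p')]. A symmetric norm is
   monotone under weak log-majorization and satisfies Hoelder's inequality on
   diagonal matrices. *)

Set Implicit Arguments.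
Unset Strict Implicit.
Unset Printing Implicit Defensive.

Import Order.TTheory GRing.Theory Num.Theory.
Local Open Scope ring_scope.
Local Open Scope sesquilinear_scope.

(** * Gram determinants *)

Section CauchyBinet.
Variable R : comNzRingType.

(** Leibniz expansion, with the product of the [k] sums distributed over all choices [f] of
    summation indices; the sum over permutations then collapses to a determinant in [Q]. *)
Lemma det_mulmx_sum_ffun (k n : nat) (P : 'M[R]_(k, n)) (Q : 'M[R]_(n, k)) :
  \det (P *m Q) =
  \sum_(f : {ffun 'I_k -> 'I_n}) (\prod_i P i (f i)) * \det (rowsub f Q).
Proof.
transitivity (\sum_(s : 'S_k) \sum_(f : {ffun 'I_k -> 'I_n})
    (-1) ^+ s * \prod_i (P i (f i) * Q (f i) (s i))).
  apply: eq_bigr => s _; rewrite -big_distrr; congr (_ * _).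
  rewrite -(bigA_distr_bigA (fun i j => P i j * Q j (s i))) /=.
  by apply: eq_bigr => i _; rewrite mxE.
rewrite exchange_big; apply: eq_bigr => f _ /=.
rewrite big_distrr; apply: eq_bigr => s _ /=.
rewrite big_split mulrCA; congr (_ * (_ * _)).
by apply: eq_bigr => i _; rewrite mxE.
Qed.

Lemma det_rowsub_perm (k n : nat) (s : 'S_k) (f : 'I_k -> 'I_n)
    (Q : 'M[R]_(n, k)) :
  \det (rowsub (f \o s) Q) = (-1) ^+ s * \det (rowsub f Q).
Proof.
rewrite -det_perm -det_mulmx -row_permE; congr (\det _).
by apply/matrixP=> i j; rewrite !mxE.
Qed.

(* Summing over all maps instead of increasing ones costs the factor [k`!] but
   removes any bookkeeping of index sets. *)
Lemma cauchy_binet (k n : nat) (P : 'M[R]_(k, n)) (Q : 'M[R]_(n, k)) :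
  k`!%:R * \det (P *m Q) =
  \sum_(f : {ffun 'I_k -> 'I_n}) \det (colsub f P) * \det (rowsub f Q).
Proof.
transitivity (\sum_(s : 'S_k) \det (P *m Q)).
  by rewrite sumr_const (eq_card (_ : _ =i predT)) ?card_Sn ?mulr_natl.
pose F f (s : 'S_k) :=
  (-1) ^+ s * \prod_i P i (f (s i)) * \det (rowsub f Q).
transitivity (\sum_(s : 'S_k) \sum_(f : {ffun 'I_k -> 'I_n}) F f s).
  apply: eq_bigr => s _; rewrite det_mulmx_sum_ffun.
  (* Reindexing by [s] turns the copy of the determinant attached to [s] into the [s]-term of the
     Leibniz formula for [\det (colsub f P)]. *)
  have bij_s : bijective (fun f : {ffun 'I_k -> 'I_n} => [ffun i => f (s i)]).
    exists (fun f : {ffun 'I_k -> 'I_n} => [ffun i => f ((s^-1)%g i)]) => f.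
    + by apply/ffunP=> i; rewrite !ffunE permKV.
    + by apply/ffunP=> i; rewrite !ffunE permK.
  rewrite (reindex _ (onW_bij _ bij_s)) /=; apply: eq_bigr => f _.
  under eq_bigr do rewrite ffunE.
  have -> : \det (rowsub [ffun i => f (s i)] Q) = (-1) ^+ s * \det (rowsub f Q).
    rewrite -det_rowsub_perm; congr (\det _).
    by apply/matrixP=> i j; rewrite !mxE ffunE.
  by rewrite /F mulrCA mulrA.
rewrite exchange_big; apply: eq_bigr => f _ /=.
rewrite -big_distrl; congr (_ * _); apply: eq_bigr => s _ /=.
by congr (_ * _); apply: eq_bigr => i _; rewrite mxE.
Qed.

End CauchyBinet.

Lemma sorted_ltn_nth_ge (s : seq nat) (i : nat) :
  sorted ltn s -> (i < size s)%N -> (i <= nth 0 s i)%N.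
Proof.
move=> s_sorted; elim: i => // i IHi lt_i_s.
apply: leq_ltn_trans (IHi (ltnW lt_i_s)) _.
by apply: (sorted_ltn_nth ltn_trans) => //; rewrite inE // ltnW.
Qed.

(** Once [s] is sorted, its entry at position [i] is at least [i], and [d] is nonincreasing. *)
Lemma prod_uniq_le (C : numDomainType) (d : nat -> C) (s : seq nat) :
  (forall i, 0 <= d i) -> {homo d : i j / (i <= j)%N >-> j <= i} -> uniq s ->
  \prod_(i <- s) d i <= \prod_(i < size s) d i.
Proof.
move=> d_ge0 d_homo s_uniq.
have ss : sorted ltn (sort leq s).
  by rewrite ltn_sorted_uniq_leq sort_uniq s_uniq sort_sorted //; apply: leq_total.
rewrite (perm_big (sort leq s)) /=; last by rewrite perm_sym perm_sort.
rewrite (big_nth 0%N) size_sort big_mkord.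
apply: ler_prod => i _; rewrite d_ge0 d_homo // sorted_ltn_nth_ge //.
by rewrite size_sort.
Qed.

Lemma prod_injective_le (C : numDomainType) (d : nat -> C) (k : nat)
    (f : 'I_k -> nat) :
  (forall i, 0 <= d i) -> {homo d : i j / (i <= j)%N >-> j <= i} ->
  injective f -> \prod_(i < k) d (f i) <= \prod_(i < k) d i.
Proof.
move=> d_ge0 d_homo f_inj.
have := @prod_uniq_le _ d (map f (enum 'I_k)) d_ge0 d_homo.
by rewrite map_inj_uniq // enum_uniq big_map big_enum size_map -cardE card_ord; apply.
Qed.

Section GramDet.
Variable C : numClosedFieldType.

(** The diagonal is a sequence on [nat], so that [diagC n d] and [diagC k d] share it and products
    over [i < k] need no index casts. *)
Definition diagC (n : nat) (d : nat -> C) : 'M[C]_n := diag_mx (\row_i d i).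

Lemma trmxC_mul (m n p : nat) (A : 'M[C]_(m, n)) (B : 'M[C]_(n, p)) :
  (A *m B)^t* = B^t* *m A^t*.
Proof. by rewrite trmx_mul map_mxM. Qed.

Lemma det_trmxC (n : nat) (A : 'M[C]_n) : \det (A^t*) = (\det A)^*.
Proof. by rewrite det_map_mx det_tr. Qed.

(** Cauchy-Binet: the minors of the adjoint are conjugates of those of [W], and the diagonal factor
    scales the rows. *)
Lemma gram_sum (k n : nat) (d : nat -> C) (W : 'M[C]_(n, k)) :
  k`!%:R * \det (W^t* *m diagC n d *m W) =
  \sum_(f : {ffun 'I_k -> 'I_n}) (\prod_i d (f i)) * `|\det (rowsub f W)| ^+ 2.
Proof.
rewrite -mulmxA cauchy_binet; apply: eq_bigr => f _.
have -> : colsub f (W^t*) = (rowsub f W)^t* by apply/matrixP=> i j; rewrite !mxE.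
have -> : rowsub f (diagC n d *m W) = diag_mx (\row_i d (f i)) *m rowsub f W.
  by apply/matrixP=> i j; rewrite mul_diag_mx [LHS]mxE mul_diag_mx !mxE.
rewrite det_trmxC det_mulmx det_diag mulrCA normCK [_^* * _]mulrC.
by congr (_ * _); apply: eq_bigr => i _; rewrite mxE.
Qed.

Lemma diagC1 (n : nat) : diagC n (fun=> 1) = 1%:M.
Proof. by apply/matrixP=> i j; rewrite !mxE. Qed.

Lemma gram_sum1 (k n : nat) (W : 'M[C]_(n, k)) :
  k`!%:R * \det (W^t* *m W) =
  \sum_(f : {ffun 'I_k -> 'I_n}) `|\det (rowsub f W)| ^+ 2.
Proof.
have := gram_sum (fun=> 1) W; rewrite diagC1 mulmx1 => ->.
by apply: eq_bigr => f _; rewrite big1 ?mul1r.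
Qed.

Lemma fact_gt0C (k : nat) : 0 < k`!%:R :> C.
Proof. by rewrite ltr0n fact_gt0. Qed.

Lemma det_gram_ge0 (k n : nat) (W : 'M[C]_(n, k)) : 0 <= \det (W^t* *m W).
Proof.
by rewrite -(pmulr_rge0 _ (fact_gt0C k)) gram_sum1 sumr_ge0 // => f _; rewrite exprn_ge0.
Qed.

(** Termwise in [gram_sum]: a non-injective [f] repeats a row and contributes zero, and for an
    injective [f] the product of the [d (f i)] is at most the product of the first [k] values. *)
Lemma det_gram_diag_le (k n : nat) (d : nat -> C) (W : 'M[C]_(n, k)) :
  (forall i, 0 <= d i) -> {homo d : i j / (i <= j)%N >-> j <= i} ->
  \det (W^t* *m diagC n d *m W) <= (\prod_(i < k) d i) * \det (W^t* *m W).
Proof.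
move=> d_ge0 d_homo; rewrite -(ler_pM2l (fact_gt0C k)) mulrCA gram_sum gram_sum1.
rewrite mulr_sumr; apply: ler_sum => f _.
have [f_inj|/injectivePn [i1 [i2 ne_i eq_f]]] := boolP (injectiveb f).
  apply: ler_wpM2r; first by rewrite exprn_ge0.
  apply: (@prod_injective_le _ d k (fun i => f i)) => //.
  by move=> i j /val_inj; apply: (injectiveP _ f_inj).
rewrite (determinant_alternate ne_i) ?normr0 ?expr0n ?mulr0 // => j.
by rewrite !mxE eq_f.
Qed.

Lemma sum_CauchySchwarz (I : finType) (u v : I -> C) :
  `|\sum_i (u i)^* * v i| ^+ 2 <= (\sum_i `|u i| ^+ 2) * (\sum_i `|v i| ^+ 2).
Proof.
rewrite -subr_ge0 -(pmulr_rge0 _ (ltr0n C 2)).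
(* Lagrange's identity. *)
suff -> : 2%:R * ((\sum_i `|u i| ^+ 2) * (\sum_i `|v i| ^+ 2) -
    `|\sum_i (u i)^* * v i| ^+ 2) =
    \sum_i \sum_j `|u i * v j - u j * v i| ^+ 2.
  by rewrite sumr_ge0 // => i _; rewrite sumr_ge0 // => j _; rewrite exprn_ge0.
transitivity (\sum_i \sum_j (`|u i| ^+ 2 * `|v j| ^+ 2 + `|u j| ^+ 2 * `|v i| ^+ 2 -
    ((u i)^* * v i * ((u j)^* * v j)^* + (u j)^* * v j * ((u i)^* * v i)^*))).
  under [RHS]eq_bigr => i _ do rewrite !big_split sumrN big_split /=
    -!mulr_sumr -!mulr_suml -rmorph_sum.
  rewrite !big_split sumrN big_split /= -!mulr_sumr -!mulr_suml -rmorph_sum normCK.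
  ring.
apply: eq_bigr => i _; apply: eq_bigr => j _.
by rewrite !normCK !rmorphB !rmorphM /= !conjCK; ring.
Qed.

(** Cauchy-Binet writes all three determinants as sums over the maps [f], which reduces the claim to
    the Cauchy-Schwarz inequality for the vectors of minors. *)
Lemma det_CauchySchwarz (k n : nat) (P Q : 'M[C]_(n, k)) :
  `|\det (P^t* *m Q)| ^+ 2 <= \det (P^t* *m P) * \det (Q^t* *m Q).
Proof.
rewrite -(ler_pM2l (exprn_gt0 2 (fact_gt0C k))) -[X in X ^+ 2 * _ <= _]normr_nat.
rewrite -exprMn -normrM cauchy_binet [X in _ <= X * _]expr2 mulrACA !gram_sum1.
under eq_bigr => f _.
  have -> : colsub f (P^t*) = (rowsub f P)^t* by apply/matrixP=> i j; rewrite !mxE.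
  rewrite det_trmxC; over.
exact: sum_CauchySchwarz.
Qed.

End GramDet.

(** * Products of top eigenvalues *)

Section Spectral.
Variable C : numClosedFieldType.

Record eigendec (n : nat) (H U : 'M[C]_n) (d : nat -> C) : Prop := {
  eigen_unitary : U \is unitarymx;
  eigen_ge0 : forall i, 0 <= d i;
  eigen_homo : {homo d : i j / (i <= j)%N >-> j <= i};
  eigenE : H = U^t* *m diagC n d *m U }.

Lemma eigendec_exists (n : nat) (H : 'M[C]_n) : H \is hermsymmx ->
  (forall v : 'cV[C]_n, 0 <= (v^t* *m H *m v) 0 0) ->
  exists U d, eigendec H U d.
Proof.
move=> H_herm H_ge0.
have := hermitian_normalmx H_herm => /orthomx_spectralP.
set P := spectralmx H; set sp := spectral_diag H => HE.
have Pu : P \is unitarymx by apply: spectral_unitarymx.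
rewrite invmx_unitary // in HE.
have sp_ge0 i : 0 <= sp 0 i.
  have := H_ge0 (P^t* *m delta_mx i 0).
  rewrite HE trmxC_mul trmxCK !mulmxA -(mulmxA _ P) (unitarymxP Pu) mulmx1.
  rewrite -(mulmxA _ P) (unitarymxP Pu) mulmx1 mul_mx_diag mxE (bigD1 i) //=.
  rewrite big1 => [|j /negPf ne_ji]; last by rewrite !mxE ne_ji mulr0.
  by rewrite !mxE !eqxx addr0 !mulr1 rmorph1 mul1r.
(* Beyond index [n] the default value [0] of [nth] keeps the sorted sequence nonnegative and
   nonincreasing on all of [nat]. *)
pose t := [tuple sp 0 i | i < n]; pose s := sort (>=%O) t.
have t_ge0 : all (fun x : C => 0 <= x) t.
  by apply/allP=> x /mapP [i _ ->].
have s_ge0 i : 0 <= nth 0 s i.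
  have [lt_is|le_si] := ltnP i (size s); last by rewrite nth_default.
  by apply: (allP t_ge0); rewrite -(mem_sort (>=%O)) mem_nth.
(* The order on [C] is partial; sorting is justified because nonnegative elements are comparable. *)
have s_sorted : sorted (>=%O) s.
  apply: (sort_sorted_in _ t_ge0) => x y x_ge0 y_ge0.
  by rewrite orbC; apply: real_leVge; apply: ger0_real.
have size_s : size s = n by rewrite size_sort size_tuple.
have [p pE] : exists p : 'S_n, s = [tuple tnth t (p i) | i < n].
  by apply/tuple_permP; rewrite perm_sort.
have nth_s (i : 'I_n) : nth 0 s i = sp 0 (p i).
  by rewrite pE -[nth _ _ _](tnth_nth 0) !tnth_mktuple.
exists (row_perm p P), (nth 0 s); split=> //.
- rewrite row_permE mul_unitarymx //; apply/unitarymxP.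
  by rewrite tr_perm_mx map_perm_mx -perm_mxM mulgV perm_mx1.
- move=> i j le_ij; have [lt_js|le_sj] := ltnP j (size s); last first.
    by rewrite [nth _ _ j]nth_default.
  apply: (sorted_leq_nth ge_trans ge_refl _ s_sorted); rewrite ?inE //.
  exact: leq_ltn_trans lt_js.
- apply/matrixP=> i j; rewrite HE mxE [RHS]mxE (reindex_inj (@perm_inj _ p)).
  by apply: eq_bigr => l _ /=; rewrite !mul_mx_diag !mxE nth_s.
Qed.

Lemma gram_herm (m n : nat) (X : 'M[C]_(m, n)) : X^t* *m X \is hermsymmx.
Proof. by apply/is_hermitianmxP; rewrite expr0 scale1r trmxC_mul trmxCK. Qed.

Lemma gram_ge0 (m n : nat) (X : 'M[C]_(m, n)) (v : 'cV[C]_n) :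
  0 <= (v^t* *m (X^t* *m X) *m v) 0 0.
Proof.
have -> : v^t* *m (X^t* *m X) *m v = (X *m v)^t* *m (X *m v).
  by rewrite trmxC_mul !mulmxA.
by rewrite mxE sumr_ge0 // => i _; rewrite !mxE mulrC mul_conjC_ge0.
Qed.

Lemma gram_eigendec (m n : nat) (X : 'M[C]_(m, n)) :
  exists U d, eigendec (X^t* *m X) U d.
Proof. by apply: eigendec_exists; [apply: gram_herm | apply: gram_ge0]. Qed.

Lemma det_gram_le (k m n : nat) (X : 'M[C]_(m, n)) U d (W : 'M[C]_(n, k)) :
  eigendec (X^t* *m X) U d ->
  \det ((X *m W)^t* *m (X *m W)) <= (\prod_(i < k) d i) * \det (W^t* *m W).
Proof.
move=> [Uu d_ge0 d_homo XE].
have -> : (X *m W)^t* *m (X *m W) = (U *m W)^t* *m diagC n d *m (U *m W).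
  by rewrite !trmxC_mul !mulmxA -(mulmxA (W^t*)) XE !mulmxA.
apply: le_trans (det_gram_diag_le _ d_ge0 d_homo) _.
by rewrite trmxC_mul mulmxA mulmxKtV.
Qed.

Lemma diagC_pid (n k : nat) (d : nat -> C) :
  diagC n d *m (pid_mx k : 'M_(n, k)) = pid_mx k *m diagC k d.
Proof.
apply/matrixP=> i j; rewrite mul_diag_mx mul_mx_diag !mxE.
by case: (eqVneq (val i) j) => [->|]; rewrite ?mulr0 ?mul0r // mulrC.
Qed.

(** The factor [pid_mx k] keeps the first [k] columns of the adjoint of [U], which are orthonormal
    eigenvectors for the [k] largest eigenvalues. *)
Lemma eigen_top (n k : nat) (H U : 'M[C]_n) d (V := U^t* *m (pid_mx k : 'M_(n, k))) :
  (k <= n)%N -> eigendec H U d ->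
  V^t* *m V = 1%:M /\ H *m V = V *m diagC k d.
Proof.
move=> le_kn [Uu _ _ HE]; split.
  rewrite trmxC_mul trmxCK !mulmxA -(mulmxA _ U) (unitarymxP Uu) mulmx1.
  by rewrite tr_pid_mx map_pid_mx mul_pid_mx minnn (minn_idPr le_kn) pid_mx_1.
by rewrite HE /V !mulmxA -(mulmxA _ U) (unitarymxP Uu) mulmx1 -!mulmxA diagC_pid.
Qed.

(* With [W = G V], [V] an orthonormal family of top eigenvectors of [X0^* X0],
   the intertwining relation gives [X1^* X2 W = W diag(d0)], so that the product
   of the top eigenvalues is read off [det ((X1 W)^* (X2 W))]. [W] need not be
   orthonormal, but [G' W = V] makes its Gram determinant nonzero. *)
Lemma prod_eigen_sqr_le (k n : nat) (X0 X1 X2 G G' U0 U1 U2 : 'M[C]_n) d0 d1 d2 :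
  (k <= n)%N ->
  eigendec (X0^t* *m X0) U0 d0 ->
  eigendec (X1^t* *m X1) U1 d1 ->
  eigendec (X2^t* *m X2) U2 d2 ->
  X1^t* *m X2 *m G = G *m (X0^t* *m X0) ->
  G' *m G *m (X0^t* *m X0) = X0^t* *m X0 ->
  (\prod_(i < k) d0 i) ^+ 2 <= (\prod_(i < k) d1 i) * (\prod_(i < k) d2 i).
Proof.
move=> le_kn H0 H1 H2 GE G'E.
have p_ge0 H U d : eigendec H U d -> 0 <= \prod_(i < k) d i.
  by move=> [_ d_ge0 _ _]; apply: prodr_ge0.
have [->|p0_neq0] := eqVneq (\prod_(i < k) d0 i) 0.
  by rewrite expr0n /=; apply: mulr_ge0; [exact: p_ge0 H1 | exact: p_ge0 H2].
have [VV HV] := eigen_top le_kn H0.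
set V := U0^t* *m _ in VV HV; set H := X0^t* *m _ in H0 HV GE G'E.
move: (H) (V) H0 VV HV GE G'E => {}H {}V H0 VV HV GE G'E.
pose W := G *m V; pose g := \det (W^t* *m W).
have d0_unit : diagC k d0 \in unitmx.
  by rewrite unitmxE unitfE det_diag; under eq_bigr do rewrite mxE.
(* Invertibility of [diagC k d0] puts the columns of [V] in the range of [H], where [G' *m G] acts
   as the identity. *)
have VE : G' *m W = V.
  have VK : V = H *m V *m invmx (diagC k d0) by rewrite HV mulmxK.
  by rewrite /W VK !mulmxA G'E.
(* If [g] vanished, so would the Gram determinant of [G' *m W = V], which is [1]. *)
have g_gt0 : 0 < g.
  rewrite lt_neqAle det_gram_ge0 andbT eq_sym; apply/eqP => g0.
  have [U [d Gd]] := gram_eigendec G'.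
  have := det_gram_le W Gd; rewrite VE VV det1 -/g g0 mulr0.
  by rewrite ler10.
have := det_CauchySchwarz (X1 *m W) (X2 *m W).
have -> : (X1 *m W)^t* *m (X2 *m W) = W^t* *m W *m diagC k d0.
  rewrite trmxC_mul -!mulmxA; congr (_ *m _).
  by rewrite -HV !mulmxA GE.
rewrite det_mulmx det_diag; under [X in _ * X]eq_bigr do rewrite mxE.
rewrite -/g ger0_norm ?mulr_ge0 ?(ltW g_gt0) ?(p_ge0 _ _ _ _ H0) // => le_det.
have := le_trans le_det (ler_pM (det_gram_ge0 _) (det_gram_ge0 _)
  (det_gram_le W H1) (det_gram_le W H2)).
by rewrite -/g mulrACA -expr2 exprMn mulrC ler_pM2r // exprn_gt0.
Qed.

End Spectral.

(** * Midpoint log-convexity *)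

(** Young's inequality with the conjugate exponents [l^-1] and [(1 - l)^-1]. *)
Lemma powR_AMGM (R : realType) (x y l : R) : 0 <= x -> 0 <= y -> 0 < l -> l < 1 ->
  powR x l * powR y (1 - l) <= l * x + (1 - l) * y.
Proof.
move=> x_ge0 y_ge0 l_gt0 l_lt1; have l'_gt0 : 0 < 1 - l by rewrite subr_gt0.
have := @conjugate_powR R _ _ l^-1 (1 - l)^-1 (powR_ge0 x l) (powR_ge0 y (1 - l)).
rewrite !invr_gt0 !invrK (addrC l) subrK -!powRrM !divff ?gt_eqF // !powRr1 //.
by rewrite !(mulrC _ l) !(mulrC _ (1 - l)); apply.
Qed.

Lemma powRV (R : realType) (x u : R) : 0 <= x -> powR x^-1 u = (powR x u)^-1.
Proof. by move=> x_ge0; rewrite -powR_inv1 // -powRrM mulN1r powRN. Qed.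

Lemma bernoulli_le (R : realDomainType) (e : R) (n : nat) :
  0 <= e -> 1 + n%:R * e <= (1 + e) ^+ n.
Proof.
move=> e_ge0; elim: n => [|n IHn]; first by rewrite mul0r addr0 expr0.
rewrite exprS; apply: le_trans (ler_wpM2l _ IHn); last by rewrite addr_ge0.
rewrite -natr1; have : 0 <= n%:R * e * e by rewrite !mulr_ge0.
by move: (n%:R) => m; lra.
Qed.

Lemma le1_of_bounded_pow (R : realType) (x M : R) :
  (forall n, x ^+ (2 ^ n) <= M) -> x <= 1.
Proof.
move=> x_le; rewrite leNgt; apply/negP => x_gt1.
have e_gt0 : 0 < x - 1 by rewrite subr_gt0.
(* This [n] gives [M < n * (x - 1) <= 2 ^ n * (x - 1)], against Bernoulli's inequality. *)
pose n := Num.bound `|M / (x - 1)|.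
have := le_trans (bernoulli_le (2 ^ n) (ltW e_gt0)).
rewrite addrC subrK => /(_ _ (x_le n)).
have lt_n : M / (x - 1) < n%:R by apply: le_lt_trans (ler_norm _) (archi_boundP _).
rewrite leNgt => /negP; apply; apply: ltr_pwDl => //.
rewrite -ler_pdivrMr //; apply: le_trans (ltW lt_n) _.
by rewrite ler_nat ltnW // ltn_expl.
Qed.

Section LogConvex.
Variables (R : realType) (f : R -> R) (s t : R).
Hypothesis f_ge0 : forall u, 0 <= f u.
Hypothesis f_mid : forall u v, f ((u + v) / 2) ^+ 2 <= f u * f v.

Let m l := l * s + (1 - l) * t.

(* The quotient [g] of [f] by its geometric interpolation satisfies
   [g l ^+ 2 <= g l'] with [l' = 2l] or [l' = 2l - 1], so a bound [M] for [g]
   improves to [M ^ (2 ^- n)] for every [n]. *)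
Lemma midpoint_log_convex (C l : R) :
  (forall u : R, 0 <= u <= 1 -> f (m u) <= C) -> 0 < l -> l < 1 ->
  f (m l) <= powR (f s) l * powR (f t) (1 - l).
Proof.
move=> f_le l_gt0 l_lt1.
(* One zero of [f] makes [f] vanish everywhere, since [v] is the midpoint of [u] and [2 * v - u]. *)
have f_eq0 u v : f u = 0 -> f v = 0.
  move=> fu0; have := f_mid u (2 * v - u); rewrite fu0 mul0r.
  have -> : (u + (2 * v - u)) / 2 = v by field.
  by move=> fv; apply/eqP; rewrite -sqrf_eq0 eq_le fv sqr_ge0.
have [fs0|fs_neq0] := eqVneq (f s) 0.
  by rewrite (f_eq0 _ _ fs0) mulr_ge0 ?powR_ge0.
have [ft0|ft_neq0] := eqVneq (f t) 0.
  by rewrite (f_eq0 _ _ ft0) mulr_ge0 ?powR_ge0.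
have fs_gt0 : 0 < f s by rewrite lt_neqAle eq_sym fs_neq0 f_ge0.
have ft_gt0 : 0 < f t by rewrite lt_neqAle eq_sym ft_neq0 f_ge0.
pose c u := powR (f s) u * powR (f t) (1 - u).
have c_gt0 u : 0 < c u by rewrite mulr_gt0 ?powR_gt0.
pose g u := f (m u) / c u.
have g_ge0 u : 0 <= g u by rewrite divr_ge0 ?f_ge0 ?ltW.
have cD u v : c ((u + v) / 2) ^+ 2 = c u * c v.
  rewrite /c exprMn -!powR_mulrn ?powR_ge0 // -!powRrM mulrACA.
  rewrite -!powRD ?fs_neq0 ?ft_neq0 ?implybT //.
  by congr (powR _ _ * powR _ _); field.
have g_mid u v : g ((u + v) / 2) ^+ 2 <= g u * g v.
  rewrite /g expr_div_n cD [leRHS]mulrACA -invfM.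
  rewrite ler_pM2r ?invr_gt0 ?(mulr_gt0 (c_gt0 _) (c_gt0 _)) //.
  have -> : m ((u + v) / 2) = (m u + m v) / 2 by rewrite /m; field.
  exact: f_mid.
have g0 : g 0 = 1.
  by rewrite /g /m /c mul0r add0r subr0 mul1r powRr0 powRr1 ?mul1r ?divff ?f_ge0.
have g1 : g 1 = 1.
  by rewrite /g /m /c subrr mul0r addr0 mul1r powRr0 powRr1 ?mulr1 ?divff ?f_ge0.
(* On the open interval, [powR_AMGM] bounds [(c u)^-1] by the sum of the two inverses; the summand
   [1] covers the endpoints. *)
pose M := `|C| * ((f s)^-1 + (f t)^-1) + 1.
have M1 : 1 <= M by rewrite lerDr mulr_ge0 // addr_ge0 // invr_ge0 f_ge0.
have g_leM u : 0 <= u <= 1 -> g u <= M.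
  move=> /andP [u_ge0 u_le1].
  have [->|u_neq0] := eqVneq u 0; first by rewrite g0.
  have [->|u_neq1] := eqVneq u 1; first by rewrite g1.
  have u_gt0 : 0 < u by rewrite lt_neqAle eq_sym u_neq0.
  have u_lt1 : u < 1 by rewrite lt_neqAle u_neq1.
  have cV : (c u)^-1 = powR (f s)^-1 u * powR (f t)^-1 (1 - u).
    by rewrite /c !powRV ?f_ge0 // invfM.
  rewrite /g cV.
  apply: le_trans (_ : `|C| * ((f s)^-1 + (f t)^-1) <= _); last by rewrite lerDl.
  apply: ler_pM; rewrite ?f_ge0 ?mulr_ge0 ?powR_ge0 //.
    by apply: le_trans (ler_norm _); apply: f_le; rewrite u_ge0.
  apply: le_trans (powR_AMGM _ _ u_gt0 u_lt1) _; rewrite ?invr_ge0 ?f_ge0 //.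
  by apply: lerD; rewrite ler_piMl ?invr_ge0 ?f_ge0 // gerBl.
have g_pow n u : 0 <= u <= 1 -> g u ^+ (2 ^ n) <= M.
  elim: n u => [u|n IHn u u01]; first by rewrite expr1; apply: g_leM.
  have [le_u|lt_u] := leP u 2^-1.
    apply: le_trans (IHn (2 * u) _); last by move/andP: u01 => [? ?]; lra.
    rewrite expnS exprM lerXn2r ?nnegrE ?sqr_ge0 //.
    by have := g_mid (2 * u) 0; rewrite g0 mulr1 addr0 mulrC mulKf // pnatr_eq0.
  apply: le_trans (IHn (2 * u - 1) _); last by move/andP: u01 => [? ?]; lra.
  rewrite expnS exprM lerXn2r ?nnegrE ?sqr_ge0 //.
  have := g_mid (2 * u - 1) 1; rewrite g1 mulr1.
  by have -> : (2 * u - 1 + 1) / 2 = u by field.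
have : g l <= 1.
  by apply: le1_of_bounded_pow => n; apply: g_pow; rewrite !ltW.
by rewrite ler_pdivrMr // mul1r.
Qed.
End LogConvex.

(** * Symmetric gauges and log-majorization *)

Definition swap_idx (j k i : nat) : nat :=
  if i == j then k else if i == k then j else i.

Definition subst_idx (T : Type) (x : nat -> T) (j : nat) (a : T) (i : nat) : T :=
  if i == j then a else x i.

(** A symmetric gauge function of [n] variables read on sequences. As [gauge_mono] compares the
    first [n] entries, the value at a nonnegative sequence depends on them alone. *)
Record gauge (R : realType) (n : nat) (Phi : (nat -> R) -> R) : Prop := {
  gaugeD : forall x y, Phi (fun i => x i + y i) <= Phi x + Phi y;
  gaugeZ : forall c x, 0 <= c -> Phi (fun i => c * x i) = c * Phi x;
  gauge_eq0 : forall x, Phi x = 0 -> forall i, (i < n)%N -> x i = 0;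
  gauge_mono : forall x y, (forall i, (i < n)%N -> 0 <= x i <= y i) -> Phi x <= Phi y;
  gauge_swap : forall x j k, (j < n)%N -> (k < n)%N ->
    Phi (fun i => x (swap_idx j k i)) = Phi x }.

Section Gauge.
Variables (R : realType) (n : nat) (Phi : (nat -> R) -> R).
Hypothesis Phi_gauge : gauge n Phi.

Lemma gauge0 : Phi (fun=> 0) = 0.
Proof. by have := gaugeZ Phi_gauge (fun=> 0) (lexx 0); rewrite !mul0r. Qed.

Lemma gauge_ge0 (x : nat -> R) : (forall i, 0 <= x i) -> 0 <= Phi x.
Proof.
move=> x_ge0; rewrite -gauge0; apply: (gauge_mono Phi_gauge) => i _.
by rewrite lexx x_ge0.
Qed.

(** Here [x] is dominated by a convex combination of [y] and of [y] with entries [j] and [k]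
    exchanged, and both have the same gauge. *)
Lemma gauge_transfer (x y : nat -> R) (j k : nat) (c : R) :
  (j < n)%N -> (k < n)%N -> j != k ->
  (forall i, 0 <= x i) -> (forall i, 0 <= y i) ->
  0 <= c <= 1 ->
  x j <= c * y j + (1 - c) * y k -> x k <= c * y k + (1 - c) * y j ->
  (forall i, i != j -> i != k -> x i = y i) ->
  Phi x <= Phi y.
Proof.
move=> lt_jn lt_kn ne_jk x_ge0 y_ge0 /andP [c_ge0 c_le1] xj xk xE.
have c'_ge0 : 0 <= 1 - c by rewrite subr_ge0.
pose z i := c * y i + (1 - c) * y (swap_idx j k i).
apply: (@le_trans _ _ (Phi z)).
  apply: (gauge_mono Phi_gauge) => i _; rewrite x_ge0 /z /swap_idx /=.
  have [->//|ne_ij] := eqVneq i j.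
  have [->//|ne_ik] := eqVneq i k.
  by rewrite xE // -mulrDl addrC subrK mul1r.
apply: le_trans (gaugeD Phi_gauge _ _) _.
by rewrite !(gaugeZ Phi_gauge) // (gauge_swap Phi_gauge) // -mulrDl addrC subrK mul1r.
Qed.

Lemma gauge_powR_holder (x y : nat -> R) (l : R) :
  (forall i, 0 <= x i) -> (forall i, 0 <= y i) -> 0 < l -> l < 1 ->
  Phi (fun i => powR (x i) l * powR (y i) (1 - l)) <=
  powR (Phi x) l * powR (Phi y) (1 - l).
Proof.
move=> x_ge0 y_ge0 l_gt0 l_lt1; have l'_gt0 : 0 < 1 - l by rewrite subr_gt0.
set w := fun i => _.
have w_ge0 i : 0 <= w i by rewrite mulr_ge0 ?powR_ge0.
have w0 : (forall i, (i < n)%N -> w i = 0) -> Phi w <= 0.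
  move=> wE; rewrite -gauge0; apply: (gauge_mono Phi_gauge) => i lt_in.
  by rewrite wE ?lexx.
have [Px0|Px_neq0] := eqVneq (Phi x) 0.
  rewrite Px0 powR0 ?gt_eqF // mul0r; apply: w0 => i lt_in.
  by rewrite /w (gauge_eq0 Phi_gauge Px0) // powR0 ?gt_eqF // mul0r.
have [Py0|Py_neq0] := eqVneq (Phi y) 0.
  rewrite Py0 [X in _ * X]powR0 ?gt_eqF // mulr0; apply: w0 => i lt_in.
  by rewrite /w (gauge_eq0 Phi_gauge Py0) // [X in _ * X]powR0 ?gt_eqF // mulr0.
have Px_gt0 : 0 < Phi x by rewrite lt_neqAle eq_sym Px_neq0 gauge_ge0.
have Py_gt0 : 0 < Phi y by rewrite lt_neqAle eq_sym Py_neq0 gauge_ge0.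
set c := _ * _; have c_gt0 : 0 < c by rewrite mulr_gt0 ?powR_gt0.
rewrite -[leRHS]mulr1 -ler_pdivrMl // -(gaugeZ Phi_gauge) ?invr_ge0 ?(ltW c_gt0) //.
(* Normalized so that [Phi u = l] and [Phi v = 1 - l]; the weighted mean inequality then holds entry
   by entry. *)
pose u i := l / Phi x * x i; pose v i := (1 - l) / Phi y * y i.
apply: (@le_trans _ _ (Phi (fun i => u i + v i))).
  apply: (gauge_mono Phi_gauge) => i _; rewrite mulr_ge0 ?invr_ge0 ?(ltW c_gt0) //=.
  rewrite /c invfM mulrACA -!powRV ?(ltW Px_gt0) ?(ltW Py_gt0) //.
  rewrite -!powRM ?invr_ge0 ?(ltW Px_gt0) ?(ltW Py_gt0) //.
  rewrite /u /v -!mulrA; apply: powR_AMGM => //;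
    rewrite mulr_ge0 ?invr_ge0 ?x_ge0 ?y_ge0 ?(ltW Px_gt0) ?(ltW Py_gt0) //.
apply: le_trans (gaugeD Phi_gauge u v) _.
rewrite !(gaugeZ Phi_gauge) ?(divr_ge0 (ltW l_gt0)) ?(divr_ge0 (ltW l'_gt0)) //;
  rewrite ?gauge_ge0 // -!mulrA !mulVf ?gt_eqF // !mulr1.
by rewrite addrC subrK.
Qed.

(* Descent on the number of indices where [x] and [y] differ. Let [k] be the
   first index with [y k < x k] and [j < k] the last one before it with
   [x j < y j]; dividing [y j] by [r] and multiplying [y k] by [r] for the
   largest admissible [r] keeps the hypotheses, does not increase [Phi], and
   creates a new coincidence. *)
Lemma gauge_log_majorization (x y : nat -> R) :
  (forall i, 0 <= x i) -> (forall i, 0 <= y i) ->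
  {homo x : i j / (i <= j)%N >-> j <= i} ->
  (forall k, (k <= n)%N -> \prod_(i < k) x i <= \prod_(i < k) y i) ->
  Phi x <= Phi y.
Proof.
move=> x_ge0 y_ge0 x_homo.
have [m] := ubnP #|[set i : 'I_n | x i != y i]|.
elim: m y y_ge0 => // m IHm y y_ge0 lt_m xy.
have [/existsP [k0 k0P]|] := boolP [exists k : 'I_n, y k < x k]; last first.
  rewrite negb_exists => /forallP le_xy; apply: (gauge_mono Phi_gauge) => i lt_in.
  by rewrite x_ge0 /= leNgt; apply: (le_xy (Ordinal lt_in)).
have ex_k : exists k, (k < n)%N && (y k < x k) by exists k0; rewrite ltn_ord.
case: (ex_minnP ex_k) => k /andP [lt_kn lt_yxk] k_min {k0 k0P ex_k}.
have xk_gt0 : 0 < x k by apply: le_lt_trans lt_yxk.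
have x_gt0 i : (i <= k)%N -> 0 < x i.
  by move=> le_ik; apply: lt_le_trans (x_homo _ _ le_ik).
have le_before i : (i < k)%N -> x i <= y i.
  move=> lt_ik; rewrite leNgt; apply/negP => lt_yx.
  by have := k_min i; rewrite lt_yx (ltn_trans lt_ik) // leqNgt lt_ik => /(_ isT).
(* Otherwise the products over [i < k] agree, and [y k < x k] contradicts the hypothesis at
   [k.+1]. *)
have ex_j : exists j, (j < k)%N && (x j < y j).
  have [/existsP [j jP]|] := boolP [exists j : 'I_k, x j < y j].
    by exists j; rewrite ltn_ord.
  rewrite negb_exists => /forallP le_yx.
  have := xy k.+1 lt_kn; rewrite !big_ord_recr /=.
  have -> : \prod_(i < k) y i = \prod_(i < k) x i.
    by apply: eq_bigr => i _; apply/eqP; rewrite eq_le le_before // leNgt le_yx.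
  rewrite ler_pM2l ?prodr_gt0 // => [|i _]; first by rewrite leNgt lt_yxk.
  by rewrite x_gt0 // ltnW.
have j_bound i : (i < k)%N && (x i < y i) -> (i <= k)%N by move=> /andP [/ltnW].
case: (ex_maxnP ex_j j_bound) => j /andP [lt_jk lt_xyj] j_max {ex_j j_bound}.
have lt_jn : (j < n)%N by apply: ltn_trans lt_kn.
have ne_jk : j != k by rewrite neq_ltn lt_jk.
have between i : (j < i)%N -> (i < k)%N -> x i = y i.
  move=> lt_ji lt_ik; apply/eqP; rewrite eq_le le_before //= leNgt; apply/negP => lt_xy.
  by have := j_max i; rewrite lt_ik lt_xy leqNgt lt_ji => /(_ isT).
have xj_gt0 : 0 < x j by rewrite x_gt0 // ltnW.
have yj_gt0 : 0 < y j by apply: lt_trans lt_xyj.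
have le_xkj : x k <= x j by apply: x_homo; apply: ltnW.
have yk_gt0 : 0 < y k.
  rewrite lt_neqAle y_ge0 andbT eq_sym; apply/eqP => yk0.
  have := xy k.+1 lt_kn; rewrite !big_ord_recr /= yk0 mulr0 leNgt.
  by rewrite mulr_gt0 // prodr_gt0 // => i _; rewrite x_gt0 // ltnW.
pose r := Num.min (y j / x j) (x k / y k).
have r_gt1 : 1 < r by rewrite lt_min !ltr_pdivlMr // !mul1r lt_xyj.
have r_gt0 : 0 < r by apply: lt_trans r_gt1.
have rj : r * x j <= y j by rewrite -ler_pdivlMr // ge_min lexx.
have rk : r * y k <= x k by rewrite -ler_pdivlMr // ge_min lexx orbT.
have r_eq : (r * x j == y j) || (r * y k == x k).
  by rewrite /r; case: leP => _;
    rewrite divfK ?(gt_eqF xj_gt0) ?(gt_eqF yk_gt0) ?eqxx ?orbT.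
pose y' := subst_idx (subst_idx y k (r * y k)) j (y j / r).
have y'j : y' j = y j / r by rewrite /y' /subst_idx eqxx.
have y'k : y' k = r * y k by rewrite /y' /subst_idx eqxx eq_sym (negPf ne_jk).
have y'i i : i != j -> i != k -> y' i = y i.
  by move=> /negPf ne_ij /negPf ne_ik; rewrite /y' /subst_idx ne_ij ne_ik.
have y'_ge0 i : 0 <= y' i.
  have [->|ne_ij] := eqVneq i j; first by rewrite y'j divr_ge0 // ltW.
  have [->|ne_ik] := eqVneq i k; first by rewrite y'k mulr_ge0 // ltW.
  by rewrite y'i.
have le_xy'j : x j <= y' j by rewrite y'j ler_pdivlMr // mulrC.
apply: (@le_trans _ _ (Phi y')).
  apply: IHm => //.
    apply: leq_trans (_ : #|[set i : 'I_n | x i != y i]| <= m)%N => //.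
    apply: proper_card; apply/properP; split.
      apply/fintype.subsetP => i; rewrite !inE.
      have [->|ne_ij] := eqVneq (val i) j; first by rewrite (lt_eqF lt_xyj).
      have [->|ne_ik] := eqVneq (val i) k; first by rewrite (gt_eqF lt_yxk).
      by rewrite y'i.
    case/orP: r_eq => /eqP r_eq.
      exists (Ordinal lt_jn); rewrite !inE /= ?(lt_eqF lt_xyj) // negbK y'j -r_eq.
      by rewrite mulrC mulKf ?(gt_eqF r_gt0).
    by exists (Ordinal lt_kn); rewrite !inE /= ?(gt_eqF lt_yxk) // negbK y'k r_eq.
  (* For [l <= j] nothing has changed; for [j < l <= k] the factors of [y'] from [j] on dominate
     those of [x]; for [l > k] the factors [r^-1] and [r] cancel. *)
  move=> l le_ln; have [le_lj|lt_jl] := leqP l j.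
    rewrite [leRHS](eq_bigr (fun i : 'I_l => y i)) ?xy // => i _.
    by rewrite y'i // neq_ltn (leq_trans (ltn_ord i)) // (leq_trans le_lj) // ltnW.
  have [le_lk|lt_kl] := leqP l k.
    have split_j (z : nat -> R) : \prod_(i < l) z i =
        \prod_(0 <= i < j) z i * \prod_(j <= i < l) z i.
      by rewrite -(big_mkord xpredT) (big_cat_nat (n := j)) // ltnW.
    rewrite !split_j.
    have y'E : \prod_(0 <= i < j) y' i = \prod_(0 <= i < j) y i.
      apply: eq_big_nat => i /= lt_ij; rewrite y'i // neq_ltn ?lt_ij //.
      by rewrite (ltn_trans lt_ij lt_jk).
    rewrite y'E; apply: ler_pM; [exact: prodr_ge0 | exact: prodr_ge0 | |].
      by rewrite !big_mkord xy // ltnW.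
    rewrite big_nat [leRHS]big_nat; apply: ler_prod => i /andP [le_ji lt_il].
    rewrite x_ge0 /=.
    move: le_ji; rewrite leq_eqVlt => /orP [/eqP <- //|lt_ji].
    have lt_ik := leq_trans lt_il le_lk.
    by rewrite y'i ?between // neq_ltn ?lt_ik ?lt_ji ?orbT.
  apply: le_trans (xy _ le_ln) _.
  pose oj := Ordinal (ltn_trans lt_jk lt_kl); pose ok := Ordinal lt_kl.
  have ne_o : ok != oj by rewrite -val_eqE eq_sym.
  rewrite (bigD1 oj) // (bigD1 ok) //= [leRHS](bigD1 oj) //=.
  rewrite [X in _ <= _ * X](bigD1 ok) //=.
  rewrite y'j y'k !mulrA divfK ?(gt_eqF r_gt0) //.
  rewrite (eq_bigr (fun i : 'I_l => y' i)) // => i /andP [ne_j ne_k].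
  by rewrite y'i.
have lt_ykj : y k < y j by apply: lt_le_trans lt_yxk (le_trans le_xkj (ltW lt_xyj)).
have d_gt0 : 0 < y j - y k by rewrite subr_gt0.
have le_yky'j : y k <= y' j by apply: le_trans (le_trans (ltW lt_yxk) le_xkj) le_xy'j.
(* The weight [c] is solved from the equation at [j]; the opposite combination then follows from the
   sum [y j + y k]. *)
have cE : let c := (y' j - y k) / (y j - y k) in
   c * y j + (1 - c) * y k = y' j /\ c * y k + (1 - c) * y j = y j + y k - y' j.
  by split; field; rewrite gt_eqF.
move: cE; set c := _ / _ => -[c_j c_k].
apply: (@gauge_transfer _ _ j k c) => //; rewrite ?c_j ?c_k //.
  rewrite divr_ge0 ?subr_ge0 ?(ltW lt_ykj) //= ler_pdivrMr // mul1r lerD2r.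
  by rewrite y'j ler_pdivrMr // ler_peMr // ltW.
(* The inequality [y' k <= y j + y k - y' j] is equivalent to nonnegativity of this product. *)
rewrite y'k y'j; have : 0 <= (r - 1) * (y j / r - y k).
  by rewrite mulr_ge0 ?subr_ge0 ?(ltW r_gt1) // -y'j.
have : r * (y j / r) = y j by rewrite mulrC divfK // gt_eqF.
by move: (y j / r) => a; nra.
Qed.

End Gauge.

Local Open Scope complex_scope.

(** * Real functional calculus and symmetric norms *)

Section RealSpectrum.
Variable R : realType.
Local Notation C := R[i].

Definition diagR (n : nat) (d : nat -> R) : 'M[C]_n := diagC n (fun i => (d i)%:C).

Definition spec (n : nat) (U : 'M[C]_n) (d : nat -> R) : 'M[C]_n :=
  U^t* *m diagR n d *m U.

Lemma diagRE (n : nat) (d : nat -> R) (i j : 'I_n) :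
  diagR n d i j = if i == j then (d i)%:C else 0.
Proof. by rewrite !mxE; case: eqVneq => [->|]; rewrite ?mulr1n ?mulr0n. Qed.

Lemma eq_diagR (n : nat) (d e : nat -> R) :
  (forall i, (i < n)%N -> d i = e i) -> diagR n d = diagR n e.
Proof. by move=> de; apply/matrixP=> i j; rewrite !diagRE de. Qed.

Lemma diagRM (n : nat) (d e : nat -> R) :
  diagR n d *m diagR n e = diagR n (fun i => d i * e i).
Proof.
apply/matrixP=> i j; rewrite mul_diag_mx mxE !diagRE mxE.
by case: eqVneq => [->|]; rewrite ?mulr0 // -rmorphM.
Qed.

Lemma diagRD (n : nat) (d e : nat -> R) :
  diagR n d + diagR n e = diagR n (fun i => d i + e i).
Proof.
apply/matrixP=> i j; rewrite mxE !diagRE.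
by case: eqVneq => _; rewrite ?addr0 // rmorphD.
Qed.

Lemma diagRZ (n : nat) (c : R) (d : nat -> R) :
  c%:C *: diagR n d = diagR n (fun i => c * d i).
Proof.
apply/matrixP=> i j; rewrite mxE !diagRE.
by case: eqVneq => _; rewrite ?mulr0 // rmorphM.
Qed.

Lemma diagR1 (n : nat) : diagR n (fun=> 1) = 1%:M.
Proof. exact: diagC1. Qed.

Lemma diagR_tr (n : nat) (d : nat -> R) : (diagR n d)^T = diagR n d.
Proof. exact: tr_diag_mx. Qed.

Lemma diagR_trC (n : nat) (d : nat -> R) : (diagR n d)^t* = diagR n d.
Proof.
apply/matrixP=> i j; rewrite diagR_tr mxE diagRE.
case: eqVneq => _; last by rewrite conjC0.
by apply: conj_Creal; apply/complex_realP; exists (d i).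
Qed.

Lemma eigendec_real (n : nat) (H U : 'M[C]_n) (d : nat -> C) : eigendec H U d ->
  eigendec H U (fun i => (complex.Re (d i))%:C).
Proof.
move=> Hd; suff -> : (fun i => (complex.Re (d i))%:C) = d by [].
by apply: funext => i; apply: RRe_real; apply: ger0_real; apply: eigen_ge0 Hd _.
Qed.

Lemma psdmx_spec (n : nat) (A : 'M[C]_n) : psdmx A ->
  exists U a, [/\ U \is unitarymx, forall i, 0 <= a i & A = spec U a].
Proof.
move=> [A_herm A_ge0]; have [U [d Ad]] := eigendec_exists A_herm A_ge0.
have [Uu d_ge0 _ AE] := eigendec_real Ad.
by exists U, (fun i => complex.Re (d i)); split=> // i; rewrite -ler0c.
Qed.

Section Calculus.
Variables (n : nat) (U : 'M[C]_n).
Hypothesis U_unitary : U \is unitarymx.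

Lemma specM (d e : nat -> R) : spec U d *m spec U e = spec U (fun i => d i * e i).
Proof.
by rewrite /spec -diagRM !mulmxA (mulmxtVK _ U_unitary).
Qed.

Lemma specD (d e : nat -> R) : spec U d + spec U e = spec U (fun i => d i + e i).
Proof.
by rewrite /spec -mulmxDl -mulmxDr diagRD.
Qed.

Lemma spec1 : spec U (fun=> 1) = 1%:M.
Proof. by rewrite /spec diagR1 mulmx1 -[LHS]mul1mx mulmxA mulmxKtV. Qed.

Lemma spec0 : spec U (fun=> 0) = 0.
Proof.
rewrite /spec (_ : diagR n _ = 0) ?mulmx0 ?mul0mx //.
by apply/matrixP=> i j; rewrite diagRE mxE if_same.
Qed.

Lemma spec_trC (d : nat -> R) : (spec U d)^t* = spec U d.
Proof. by rewrite /spec !trmxC_mul trmxCK diagR_trC mulmxA. Qed.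

(** The eigenbasis chosen by [spectralmx] may differ from [U]. The change of basis [W] intertwines
    the two diagonals, so [W i j] vanishes unless the eigenvalues [i] and [j] agree; hence [W] also
    intertwines their images under [f]. *)
Lemma mxfun_spec (f : R -> R) (d : nat -> R) :
  mxfun f (spec U d) = spec U (f \o d).
Proof.
set M := spec U d.
have : M \is normalmx.
  apply/orthomx_spectral_subproof.
  by exists (U, \row_i (d i)%:C) => //=; rewrite invmx_unitary.
move/orthomx_spectralP; rewrite /mxfun.
set P := spectralmx M; set sp := spectral_diag M => ME.
have P_unit : P \in unitmx by apply: spectral_unit.
pose W := P *m U^t*.
have spW : diag_mx sp *m W = W *m diagR n d.
  have : P *m M *m U^t* = P *m M *m U^t* by [].
  rewrite {1}ME {1}/M /spec !mulmxA mulmxV // mul1mx => -> .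
  by rewrite mulmxtVK.
set F := diag_mx _.
have FW : F *m W = W *m diagR n (f \o d).
  move: (W) spW => {}W spW; apply/matrixP=> i j; rewrite mul_diag_mx mul_mx_diag !mxE.
  have /matrixP/(_ i j) := spW; rewrite mul_diag_mx mul_mx_diag !mxE.
  set w := W i j => spw.
  have [->|w_neq0] := eqVneq w 0; first by rewrite mulr0 mul0r.
  by rewrite mulrC; congr (_ * _); move: spw; rewrite mulrC => /(mulfI w_neq0) ->.
have -> : F = F *m W *m U *m invmx P.
  by rewrite /W !mulmxA mulmxKtV // mulmxK.
by rewrite FW /W !mulmxA mulVmx // mul1mx mulmxKV.
Qed.

End Calculus.

(** * Range and nullspace projections *)

Section Projections.
Variables (n : nat) (A E F G : 'M[C]_n).
Hypotheses (A_herm : A^t* = A) (EF : E + F = 1%:M).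
Hypotheses (AG : A *m G = E) (AF : A *m F = 0).

Let AT : (A^T)^t* = A^T.
Proof. by rewrite -[in RHS]A_herm -map_trmx. Qed.

Let F_tr : F^T *m A^T = 0.
Proof. by rewrite -trmx_mul AF trmx0. Qed.

Let E_tr : E^T = G^T *m A^T.
Proof. by rewrite -trmx_mul AG. Qed.

Let EF_tr : E^T + F^T = 1%:M.
Proof. by rewrite -linearD /= EF trmx1. Qed.

(** The rows of [E^T] lie in the row space of [A^T] and those of [F^T] are orthogonal to it;
    applying the projection to [E^T + F^T = 1] leaves [E^T]. *)
Lemma range_proj_eq : range_proj A = E.
Proof.
rewrite /range_proj -[RHS]trmxK; congr (_^T).
rewrite -[LHS]mul1mx -EF_tr mulmxDl.
rewrite proj_ortho_id ?proj_ortho_0 ?addr0 //; last by rewrite E_tr submxMl.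
by apply/orthomx1P; rewrite AT.
Qed.

Lemma null_proj_eq : null_proj A = F.
Proof.
rewrite /null_proj -[RHS]trmxK; congr (_^T).
rewrite -[LHS]mul1mx -EF_tr mulmxDl.
rewrite proj_ortho_0 ?proj_ortho_id ?add0r //; first by apply/sub_kermxP.
apply/orthomx1P; rewrite E_tr -mulmxA -[X in _ *m (X *m _)]AT -trmxC_mul mulmx_ker.
by rewrite trmx0 map_mx0 mulmx0.
Qed.

End Projections.

Section SpectralProjections.
Variables (n : nat) (U : 'M[C]_n) (a : nat -> R).
Hypothesis U_unitary : U \is unitarymx.

Let EF : spec U (fun i => (a i != 0)%:R) + spec U (fun i => (a i == 0)%:R) = 1%:M.
Proof.
rewrite specD -(spec1 U_unitary); congr spec; apply: funext => i.
by case: eqVneq; rewrite ?addr0 ?add0r.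
Qed.

Let AG : spec U a *m spec U (fun i => (a i)^-1) = spec U (fun i => (a i != 0)%:R).
Proof.
rewrite (specM U_unitary); congr spec; apply: funext => i.
by case: eqVneq => [->|?]; rewrite ?mul0r ?divff.
Qed.

Let AF : spec U a *m spec U (fun i => (a i == 0)%:R) = 0.
Proof.
rewrite (specM U_unitary) -(spec0 U); congr spec.
by apply: funext => i; case: eqVneq => [->|?]; rewrite ?mul0r ?mulr0.
Qed.

Lemma range_proj_spec : range_proj (spec U a) = spec U (fun i => (a i != 0)%:R).
Proof. exact: range_proj_eq (spec_trC U a) EF AG AF. Qed.

Lemma null_proj_spec : null_proj (spec U a) = spec U (fun i => (a i == 0)%:R).
Proof. exact: null_proj_eq (spec_trC U a) EF AG AF. Qed.

End SpectralProjections.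

(* The eigenvalue [0] is sent to [0] for every exponent, also where [powR 0 0 = 1]:
   this encodes the convention [A ^ 0 = E]. *)
Definition gpow (s x : R) : R := if x == 0 then 0 else powR x s.

Lemma gpow_ge0 (s x : R) : 0 <= gpow s x.
Proof. by rewrite /gpow; case: ifP => // _; apply: powR_ge0. Qed.

(** Unlike for [powR], there is no side condition: at [x = 0] both sides are [0], even when
    [s + t = 0]. *)
Lemma gpowD (s t x : R) : gpow s x * gpow t x = gpow (s + t) x.
Proof.
rewrite /gpow; case: eqVneq => [_|x_neq0]; first by rewrite mul0r.
by rewrite powRD // x_neq0 implybT.
Qed.

Lemma gpow_interp (s t l x : R) : 0 <= x -> 0 <= l <= 1 ->
  gpow (l * s + (1 - l) * t) x <= gpow s x + gpow t x.
Proof.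
move=> x_ge0 /andP [l_ge0 l_le1].
have [->|l_neq0] := eqVneq l 0.
  by rewrite mul0r add0r subr0 mul1r lerDr gpow_ge0.
have [->|l_neq1] := eqVneq l 1.
  by rewrite subrr mul0r addr0 mul1r lerDl gpow_ge0.
have l_gt0 : 0 < l by rewrite lt_neqAle eq_sym l_neq0.
have l_lt1 : l < 1 by rewrite lt_neqAle l_neq1.
rewrite /gpow; case: eqVneq => [_|x_neq0]; first by rewrite addr0.
rewrite powRD ?x_neq0 ?implybT // [l * s]mulrC [(1 - l) * t]mulrC !powRrM.
apply: le_trans (powR_AMGM (powR_ge0 _ _) (powR_ge0 _ _) l_gt0 l_lt1) _.
by apply: lerD; rewrite ler_piMl ?powR_ge0 // gerBl.
Qed.

(** For [s <= 0] the nullspace projection replaces the eigenvalue [0] by [1], and the range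
    projection then removes it; for [s > 0], [powR] already sends [0] to [0]. *)
Lemma mxpow_spec (n : nat) (U : 'M[C]_n) (a : nat -> R) (s : R) :
  U \is unitarymx -> mxpow (spec U a) s = spec U (gpow s \o a).
Proof.
move=> Uu; rewrite /mxpow; case: ifP => [s_gt0|_].
  rewrite (mxfun_spec Uu); congr spec; apply: funext => i /=.
  by rewrite /gpow; case: eqVneq => [->|//]; rewrite powR0 // gt_eqF.
rewrite (null_proj_spec _ Uu) (range_proj_spec _ Uu) specD (mxfun_spec Uu) (specM Uu).
congr spec; apply: funext => i /=; rewrite /gpow.
by case: eqVneq => _; rewrite ?mulr0 ?addr0 ?mulr1.
Qed.

End RealSpectrum.

(** * Symmetric norms as gauges of diagonal matrices *)

Section NormGauge.
Variables (R : realType) (n : nat) (N : 'M[R[i]]_n -> R).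
Hypothesis N_sym : symmetric_norm N.
Let N_norm : is_matrix_norm N := proj1 N_sym.
Let Phi (x : nat -> R) : R := N (diagR n x).

Lemma sym_norm_ge0 X : 0 <= N X.
Proof.
have N0 : N 0 = 0 by rewrite -(scale0r X) matrix_normZ // normr0 mul0r.
have := matrix_normD N_norm X (- X); rewrite subrr N0 -scaleN1r matrix_normZ //.
by rewrite normrN1 mul1r -mulr2n pmulrn_lge0.
Qed.

Lemma sym_norm_spec (U : 'M[R[i]]_n) (d : nat -> R) :
  U \is unitarymx -> N (spec U d) = Phi d.
Proof.
move=> Uu; have U'u : U^t* \is unitarymx by rewrite trmxC_unitary.
exact: (proj2 N_sym (diagR n d) _ _ U'u Uu).
Qed.

Let Phi_flip (x : nat -> R) (j : nat) :
  Phi (fun i => (if i == j then -1 else 1) * x i) = Phi x.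
Proof.
pose e (i : nat) : R := if i == j then -1 else 1.
have Fu : diagR n e \is unitarymx.
  apply/unitarymxP; rewrite diagR_trC diagRM -diagR1; apply: eq_diagR => i _.
  by rewrite /e; case: eqP; rewrite ?mulrNN mulr1.
have Iu : (1%:M : 'M[R[i]]_n) \is unitarymx.
  by apply/unitarymxP; rewrite trmx1 map_mx1 mulmx1.
have := proj2 N_sym (diagR n x) _ _ Fu Iu.
by rewrite mulmx1 diagRM.
Qed.

Let PhiD (x y : nat -> R) : Phi (fun i => x i + y i) <= Phi x + Phi y.
Proof.
by rewrite /Phi -diagRD; apply: matrix_normD N_norm _ _.
Qed.

Let PhiZ (c : R) (x : nat -> R) : 0 <= c -> Phi (fun i => c * x i) = c * Phi x.
Proof.
by move=> c_ge0; rewrite /Phi -diagRZ (matrix_normZ N_norm) ger0_norm ?ler0c.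
Qed.

(* Lowering one entry from [z j] to [c] is a convex combination of [z] and of
   [z] with the sign of its entry [j] flipped. *)
Let Phi_lower (z : nat -> R) (j : nat) (c : R) : 0 <= c <= z j ->
  Phi (subst_idx z j c) <= Phi z.
Proof.
move=> /andP [c_ge0 le_cz].
have [z0|z_neq0] := eqVneq (z j) 0.
  rewrite (_ : subst_idx z j c = z) //; apply: funext => i; rewrite /subst_idx.
  by case: eqP => // ->; apply/eqP; rewrite z0 eq_le c_ge0 -z0 le_cz.
have z_gt0 : 0 < z j by rewrite lt_neqAle eq_sym z_neq0 (le_trans c_ge0).
pose w := c / z j.
have w_ge0 : 0 <= w by rewrite divr_ge0 // ltW.
have w_le1 : w <= 1 by rewrite ler_pdivrMr // mul1r.
have -> : subst_idx z j c = fun i => (1 + w) / 2 * z i +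
    (1 - w) / 2 * ((if i == j then -1 else 1) * z i).
  apply: funext => i; rewrite /subst_idx; case: eqP => [->|_]; last by field.
  by rewrite /w; field.
apply: le_trans (PhiD _ _) _; rewrite !PhiZ ?Phi_flip; [|lra|lra].
by rewrite -mulrDl (_ : (1 + w) / 2 + (1 - w) / 2 = 1) ?mul1r //; field.
Qed.

Lemma sym_norm_gauge : gauge n Phi.
Proof.
split=> //.
- move=> x /(matrix_norm_eq0 N_norm) /matrixP x0 i lt_in.
  by have := x0 (Ordinal lt_in) (Ordinal lt_in); rewrite diagRE eqxx mxE => /complexI.
(* The entries of [y] are lowered to those of [x] one at a time. *)
- move=> x y xy; pose z m i := if (i < m)%N then x i else y i.
  suff le_z m : (m <= n)%N -> Phi (z m) <= Phi y.
    rewrite (_ : Phi x = Phi (z n)) ?le_z //; congr N; apply: eq_diagR => i lt_in.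
    by rewrite /z lt_in.
  elim: m => [_|m IHm lt_mn]; first by rewrite /z.
  apply: le_trans (IHm (ltnW lt_mn)).
  rewrite (_ : z m.+1 = subst_idx (z m) m (x m)).
    by apply: Phi_lower; rewrite /z ltnn xy.
  apply: funext => i; rewrite /z /subst_idx ltnS leq_eqVlt.
  by case: eqVneq => [->|].
- move=> x j k lt_jn lt_kn.
  pose s := tperm (Ordinal lt_jn) (Ordinal lt_kn).
  have -> : Phi (fun i => x (swap_idx j k i)) =
      N (perm_mx s *m diagR n x *m perm_mx s^-1).
    congr N; rewrite -row_permE -col_permE; apply/matrixP=> i l.
    rewrite !mxE (inj_eq perm_inj).
    case: eqVneq => // _; rewrite !mulr1n; congr ((x _)%:C).
    rewrite /s /swap_idx -[j]/(val (Ordinal lt_jn)) -[k]/(val (Ordinal lt_kn)).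
    case: tpermP => [->|->|/eqP ne_j /eqP ne_k] /=; rewrite ?eqxx //.
      by case: eqP => // ->.
    rewrite -val_eqE in ne_j; rewrite -val_eqE in ne_k.
    by rewrite (negPf ne_j) (negPf ne_k).
  have perm_unitary (r : 'S_n) : (perm_mx r : 'M[R[i]]_n) \is unitarymx.
    by apply/unitarymxP; rewrite tr_perm_mx map_perm_mx -perm_mxM mulgV perm_mx1.
  exact: (proj2 N_sym (diagR n x) _ _ (perm_unitary s) (perm_unitary (s^-1)%g)).
Qed.

End NormGauge.

(** * Singular values of A^s Z B^s *)

(** Meant for [B0 = B^m], [B1 = B^s], [B2 = B^t] and [G = B^(s - m)] with [2 m = s + t]. *)
Lemma mulmx_intertwine (R : pzRingType) (n : nat)
    (B0 B1 B2 G Y K Z : 'M[R]_n) :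
  B2 *m G = B0 -> G *m B0 = B1 ->
  B1 *m Y *m K *m Z *m B2 *m G = G *m (B0 *m Y *m K *m Z *m B0).
Proof. by move=> GB0 GB1; rewrite -GB1 -!mulmxA GB0. Qed.

Lemma mulmx_intertwine_inv (R : pzRingType) (n : nat)
    (B0 G' G Y K Z : 'M[R]_n) :
  G' *m G *m B0 = B0 ->
  G' *m G *m (B0 *m Y *m K *m Z *m B0) = B0 *m Y *m K *m Z *m B0.
Proof. by move=> GB0; rewrite -!(mulmxA B0) (mulmxA _ B0) GB0. Qed.

Lemma mulmx_regroup (R : pzRingType) (n : nat) (P' D P Z Q' E Q : 'M[R]_n) :
  P' *m D *m P *m Z *m (Q' *m E *m Q) =
  P' *m (D *m (P *m Z *m Q') *m E) *m Q.
Proof. by rewrite !mulmxA. Qed.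

Lemma gram_unitary (C : numClosedFieldType) (n : nat) (P X U : 'M[C]_n) :
  P \is unitarymx ->
  (P^t* *m X *m U)^t* *m (P^t* *m X *m U) = U^t* *m (X^t* *m X) *m U.
Proof. by move=> Pu; rewrite !trmxC_mul trmxCK !mulmxA mulmxtVK. Qed.

Lemma eigendec_unitary (C : numClosedFieldType) (n : nat) (H V U : 'M[C]_n) d :
  U \is unitarymx -> eigendec H V d -> eigendec (U^t* *m H *m U) (V *m U) d.
Proof.
move=> Uu [Vu d_ge0 d_homo ->]; split=> //; first by rewrite mul_unitarymx.
by rewrite trmxC_mul !mulmxA.
Qed.

Section SingularValues.
Variables (R : realType) (n : nat) (Z : 'M[R[i]]_n) (a b : nat -> R).
Hypotheses (a_ge0 : forall i, 0 <= a i) (b_ge0 : forall i, 0 <= b i).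
Local Notation C := R[i].

Definition dpow (c : nat -> R) (s : R) : 'M[C]_n := diagR n (gpow s \o c).

(** This is [A^s Z B^s] written in eigenbases of [A] and [B], with [Z] replaced by its matrix in
    these bases. *)
Definition sandwich (s : R) : 'M[C]_n := dpow a s *m Z *m dpow b s.

Lemma sandwichE (s : R) (i j : 'I_n) :
  sandwich s i j = (gpow s (a i))%:C * Z i j * (gpow s (b j))%:C.
Proof. by rewrite /sandwich mul_mx_diag mul_diag_mx !mxE. Qed.

Lemma dpowD (c : nat -> R) (s t : R) : dpow c s *m dpow c t = dpow c (s + t).
Proof. by rewrite /dpow diagRM; apply: eq_diagR => i _ /=; rewrite gpowD. Qed.

Lemma gram_eigendec_real (X : 'M[C]_n) : exists (h : nat -> R) V,
  eigendec (X^t* *m X) V (fun i => (h i)%:C).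
Proof.
have [V [d Xd]] := gram_eigendec X.
by exists (fun i => complex.Re (d i)), V; apply: eigendec_real Xd.
Qed.

Lemma sandwich_gram (s t : R) :
  (sandwich s)^t* *m sandwich t = dpow b s *m Z^t* *m dpow a (s + t) *m Z *m dpow b t.
Proof.
by rewrite /sandwich !trmxC_mul !diagR_trC !mulmxA -(mulmxA _ (dpow a s)) dpowD.
Qed.

Lemma eigen_real_ge0 (H V : 'M[C]_n) (h : nat -> R) :
  eigendec H V (fun i => (h i)%:C) -> forall i, 0 <= h i.
Proof. by move=> Hh i; rewrite -ler0c; apply: eigen_ge0 Hh _. Qed.

Variables (h : R -> nat -> R) (V : R -> 'M[C]_n).
Hypothesis hP : forall s,
  eigendec ((sandwich s)^t* *m sandwich s) (V s) (fun i => (h s i)%:C).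

Let h_ge0 s i : 0 <= h s i.
Proof. exact: eigen_real_ge0 (hP s) i. Qed.

(** Both Gram matrices contain the same power [s + t = m + m] of [a], so powers of [b] intertwine
    them. The product of [dpow b (m - s)] and [dpow b (s - m)] is only the range projection, which
    [dpow b m] absorbs. *)
Lemma prod_sandwich_midpoint (k : nat) (s t : R) : (k <= n)%N ->
  (\prod_(i < k) h ((s + t) / 2) i) ^+ 2 <=
  (\prod_(i < k) h s i) * (\prod_(i < k) h t i).
Proof.
move=> le_kn; rewrite -lecR rmorphXn rmorphM !rmorph_prod /=.
set m := (s + t) / 2.
have mE : m + m = s + t by rewrite /m; field.
apply: (prod_eigen_sqr_le (G := dpow b (s - m)) (G' := dpow b (m - s)) le_kn
  (hP m) (hP s) (hP t)).
  by rewrite (sandwich_gram m m) (sandwich_gram s t) mE; apply: mulmx_intertwine;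
    rewrite dpowD; congr dpow; lra.
rewrite (sandwich_gram m m); apply: mulmx_intertwine_inv.
by rewrite !dpowD; congr dpow; lra.
Qed.

(** The right-hand side is the trace of the Gram matrix, a sum of nonnegative eigenvalues. *)
Lemma eigen_le_trace (s : R) (i : nat) : (i < n)%N ->
  (h s i)%:C <= \sum_(l < n) \sum_(j < n) `|sandwich s l j| ^+ 2.
Proof.
move=> lt_in.
have [Vu _ _ HE] := hP s.
have -> : \sum_(l < n) \sum_(j < n) `|sandwich s l j| ^+ 2 =
    \tr ((sandwich s)^t* *m sandwich s).
  rewrite exchange_big; apply: eq_bigr => j _ /=; rewrite mxE.
  by apply: eq_bigr => l _; rewrite !mxE normCK mulrC.
rewrite HE mxtrace_mulC mulmxA (unitarymxP Vu) mul1mx mxtrace_diag.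
rewrite (bigD1 (Ordinal lt_in)) //= mxE lerDl sumr_ge0 // => l _.
by rewrite mxE ler0c.
Qed.

(** By [gpow_interp] each entry of the sandwich is bounded uniformly in [l], hence so are the trace
    and every eigenvalue. *)
Lemma prod_sandwich_bounded (k : nat) (s t : R) : (k <= n)%N ->
  exists M, forall l : R, 0 <= l <= 1 ->
    \prod_(i < k) h (l * s + (1 - l) * t) i <= M.
Proof.
move=> le_kn; pose g (c : nat -> R) i := gpow s (c i) + gpow t (c i).
pose K := \sum_(i < n) \sum_(j < n) (`|Z i j| * (g a i * g b j)%:C) ^+ 2.
exists (\prod_(i < k) complex.Re K) => l l01.
apply: ler_prod => i _; rewrite h_ge0 /=.
have : (h (l * s + (1 - l) * t) i)%:C <= K; last by rewrite lecE => /andP [].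
apply: le_trans (eigen_le_trace _ (leq_trans (ltn_ord i) le_kn)) _.
apply: ler_sum => j _; apply: ler_sum => j' _.
rewrite lerXn2r ?nnegrE // ?mulr_ge0 // ?ler0c ?mulr_ge0 ?addr_ge0 ?gpow_ge0 //.
rewrite sandwichE.
set x := gpow _ _; set y := gpow _ _.
have -> : x%:C * Z j j' * y%:C = Z j j' * (x * y)%:C by rewrite rmorphM mulrAC mulrC.
rewrite normrM ler_wpM2l // ger0_norm ?ler0c ?mulr_ge0 ?gpow_ge0 // lecR.
by apply: ler_pM; rewrite ?gpow_ge0 // gpow_interp.
Qed.

Lemma prod_sandwich_log_convex (k : nat) (s t l : R) : (k <= n)%N ->
  0 < l -> l < 1 ->
  \prod_(i < k) h (l * s + (1 - l) * t) i <=
  powR (\prod_(i < k) h s i) l * powR (\prod_(i < k) h t i) (1 - l).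
Proof.
move=> le_kn l_gt0 l_lt1; have [M hM] := prod_sandwich_bounded s t le_kn.
apply: (midpoint_log_convex (f := fun u => \prod_(i < k) h u i) _ _ hM) => //.
  by move=> u; apply: prodr_ge0.
by move=> u v; apply: prod_sandwich_midpoint.
Qed.

End SingularValues.

(** * Reduction of the norm to eigenvalues, and conclusion *)

Lemma powR_prod (R : realType) (k : nat) (x : nat -> R) (r : R) :
  (forall i, 0 <= x i) ->
  powR (\prod_(i < k) x i) r = \prod_(i < k) powR (x i) r.
Proof.
move=> x_ge0; elim: k => [|k IHk]; first by rewrite !big_ord0 powR1.
by rewrite !big_ord_recr /= powRM ?prodr_ge0 // IHk.
Qed.

(** The exponent is halved because [h] lists squares of singular values; [0 < q] makes [powR] and
    [gpow] agree at a zero eigenvalue. *)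
Lemma sym_norm_mxabs_pow (R : realType) (n : nat) (N : 'M[R[i]]_n -> R)
    (X V : 'M[R[i]]_n) (h : nat -> R) (q : R) :
  symmetric_norm N -> 0 < q -> eigendec (X^t* *m X) V (fun i => (h i)%:C) ->
  N (mxpow (mxabs X) q) = N (diagR n (fun i => powR (h i) (q / 2))).
Proof.
move=> N_sym q_gt0 [Vu _ _ XE].
rewrite /mxabs XE -/(diagR n h) -/(spec V h) !mxpow_spec // sym_norm_spec //.
congr N; apply: eq_diagR => i _ /=; rewrite /gpow.
have [->|h_neq0] := eqVneq (h i) 0; first by rewrite eqxx powR0 // gt_eqF // divr_gt0.
by rewrite powR_eq0 (negPf h_neq0) /= -powRrM mulrC.
Qed.

(** [X] is [Y] multiplied by unitaries on both sides, so their Gram matrices are unitarily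
    similar. *)
Lemma eigendec_sandwich (R : realType) (n : nat) (Z UA UB V : 'M[R[i]]_n)
    (a b : nat -> R) (s : R) (d : nat -> R[i])
    (Y := sandwich (UA *m Z *m UB^t*) a b s)
    (X := mxpow (spec UA a) s *m Z *m mxpow (spec UB b) s) :
  UA \is unitarymx -> UB \is unitarymx ->
  eigendec (Y^t* *m Y) V d -> eigendec (X^t* *m X) (V *m UB) d.
Proof.
move=> UAu UBu Yd.
have -> : X = UA^t* *m Y *m UB.
  by rewrite /X (mxpow_spec _ _ UAu) (mxpow_spec _ _ UBu); apply: mulmx_regroup.
by rewrite (gram_unitary _ _ UAu); apply: eigendec_unitary.
Qed.

Unset Implicit Arguments.
Set Strict Implicit.
Local Close Scope complex_scope.
Local Close Scope sesquilinear_scope.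
Local Open Scope classical_set_scope.

Theorem theorem1p2 (R : realType) (n : nat) (A B Z : 'M[R[i]]_n)
    (hA : psdmx A) (hB : psdmx B)
    (N : 'M[R[i]]_n -> R) (hN : symmetric_norm N)
    (alpha : R) (halpha : 0 < alpha) :
  log_convex_on
    ([set p : R^o | 0 < p] `*` [set: R^o])
    (fun x : R^o * R^o => let p : R := x.1 in let t : R := x.2 in
       N (mxpow (mxabs (mxpow A (t / p) *m Z *m mxpow B (t / p))) (alpha * p))).
Proof.
have [UA [a [UAu a_ge0 AE]]] := psdmx_spec hA.
have [UB [b [UBu b_ge0 BE]]] := psdmx_spec hB.
pose Z' := UA *m Z *m map_mx Num.conj UB^T.
have [h /choice [V hP]] := choice (fun s => gram_eigendec_real (sandwich Z' a b s)).
have XP s := eigendec_sandwich UAu UBu (hP s); rewrite -AE -BE in XP.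
split=> [x _ /=|]; first exact: sym_norm_ge0.
move=> [p t] [p' t'] l /= [p_gt0 _] [p'_gt0 _] l_gt0 l_lt1.
have l'_gt0 : 0 < 1 - l by rewrite subr_gt0.
rewrite -![_ *: _]/(_ * _).
set P := l * p + (1 - l) * p'; set T := l * t + (1 - l) * t'.
have P_gt0 : 0 < P by rewrite addr_gt0 // mulr_gt0.
have h_ge0 s i : 0 <= h s i := eigen_real_ge0 (hP s) i.
have pow_ge0 s r i : 0 <= powR (h s i) r := powR_ge0 _ _.
have q_ge0 : 0 <= alpha * P / 2 by rewrite divr_ge0 // ltW // mulr_gt0.
have NE (q s : R) : 0 < q ->
    N (mxpow (mxabs (mxpow A s *m Z *m mxpow B s)) q) =
    N (diagR n (fun i => powR (h s i) (q / 2))).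
  by move=> q_gt0; apply: sym_norm_mxabs_pow (XP s).
rewrite [leLHS](NE (alpha * P) (T / P) (mulr_gt0 halpha P_gt0)).
rewrite [X in _ <= powR X _ * _](NE (alpha * p) (t / p) (mulr_gt0 halpha p_gt0)).
rewrite [X in _ <= _ * powR X _](NE (alpha * p') (t' / p') (mulr_gt0 halpha p'_gt0)).
have Phi_gauge := sym_norm_gauge hN.
(* Hoelder's inequality bounds the gauge of the entrywise geometric mean, which is left to be
   compared with the left-hand side by log-majorization. *)
apply: le_trans (gauge_powR_holder Phi_gauge (pow_ge0 _ _) (pow_ge0 _ _) l_gt0 l_lt1).
apply: (gauge_log_majorization Phi_gauge) => //.
- by move=> i; rewrite mulr_ge0 ?powR_ge0.
- move=> i j le_ij; apply: (ge0_ler_powR q_ge0); rewrite ?nnegrE //.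
  by have := eigen_homo (hP (T / P)) le_ij; rewrite lecR.
move=> k le_kn.
pose m := l * p / P.
have m_gt0 : 0 < m by rewrite divr_gt0 // mulr_gt0.
have m'E : 1 - m = (1 - l) * p' / P.
  by rewrite /m /P; field; rewrite gt_eqF.
have m_lt1 : m < 1 by rewrite -subr_gt0 m'E divr_gt0 // mulr_gt0.
have -> : T / P = m * (t / p) + (1 - m) * (t' / p').
  by rewrite m'E /m /T; field; rewrite !gt_eqF.
have := prod_sandwich_log_convex a_ge0 b_ge0 hP (t / p) (t' / p') le_kn m_gt0 m_lt1.
set x := \prod_(i < k) _ => le_x.
have x_ge0 : 0 <= x by apply: prodr_ge0.
(* The power [alpha * P / 2] turns the weights [m] and [1 - m] into the exponents
   [l * (alpha * p / 2)] and [(1 - l) * (alpha * p' / 2)]. *)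
have := ge0_ler_powR q_ge0 x_ge0 _ le_x.
rewrite nnegrE mulr_ge0 ?powR_ge0 // => /(_ isT).
rewrite powRM ?powR_ge0 // -!powRrM !powR_prod //.
move/le_trans; apply; rewrite -big_split /= le_eqVlt; apply/orP; left; apply/eqP.
apply: eq_bigr => i _; rewrite -!powRrM m'E; congr (powR _ _ * powR _ _);
  by rewrite /m; field; rewrite gt_eqF.
Qed.
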